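(* Let $k,\kappa,m$ be positive integers with $k,\kappa\geqslant2$ and $\kappa\leqslant k^m$, and let $\varepsilon,\sigma,\eta>0$ satisfy \[ \varepsilon\leqslant1-\frac{1}{2\kappa},\qquad\sigma\leqslant\frac{\varepsilon^{\kappa-1}}{2\kappa},\qquad\eta\leqslant\frac{\sigma}{4^{\kappa-1}}. \] Let $A$ be a set with $|A|=k$, let $n>m$ be an integer, and let $\langle D_t:t\in A^n\rangle$ be an $\eta$-stationary stochastic process in a probability space $(\Omega,\mathcal{F},\mathbb{P})$ with $|\mathbb{P}(D_t)-\varepsilon|\leqslant\eta$ for every $t\in A^n$. Then either \begin{enumerate} \item[(i)] for every nonempty $G\subseteq A^n$ with $|G|\leqslant\kappa$ and whose type $\tau(G)$ has dimension at most $m$, we have $\big|\mathbb{P}\big(\bigcap_{t\in G}D_t\big)-\varepsilon^{|G|}\big|\leqslant\sigma$; or \item[(ii)] there exists $\ell\in[m]$ with the following property: for every $\ell$-tuple $\mathbf{r}=(r_1,\dots,r_\ell)$ of positive integers with $r\coloneqq\sum_{l=1}^\ell r_l\leqslant n-m$, there exist an $r$-dimensional combinatorial subspace $V$ of $A^n$ and a process $\langle S_t:t\in V\rangle$ in $(\Omega,\mathcal{F},\mathbb{P})$ which is $(\ell,\mathbf{r})$-simplicial in $V$ such that for every $t\in V$, \[ \mathbb{P}(S_t)\geqslant\frac{\varepsilon^{\kappa-1}}{4\kappa}\quad\text{and}\quad\mathbb{P}(D_t\,|\,S_t)\geqslant\varepsilon+\frac{\sigma}{4^{\kappa-1}}.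 \] \end{enumerate}
   Context: $A^n$ denotes sequences of length $n$ in $A$; $t(i)$ or $t_i$ is the $i$-th coordinate of $t$. For variables $x_1,\dots,x_d\notin A$, a $d$-variable word over $A$ of length $n$ is a sequence $v$ of length $n$ in $A\cup\{x_1,\dots,x_d\}$ in which each $x_i$ appears and, for $i<j$, all appearances of $x_i$ precede all appearances of $x_j$; $v(\alpha_1,\dots,\alpha_d)$ replaces each $x_i$ by $\alpha_i$. A combinatorial space is $V=\{v(\alpha_1,\dots,\alpha_d):\alpha_i\in A\}$, of dimension $d$, with canonical isomorphism $\mathrm{I}_V\colon A^d\to V$, $(\alpha_1,\dots,\alpha_d)\mapsto v(\alpha_1,\dots,\alpha_d)$; a combinatorial subspace of $A^n$ is a combinatorial space contained in $A^n$. Type: for $G\subseteq A^n$ with $|G|=p\geqslant2$, enumerate it as $(u_1,\dots,u_p)$, let $R$ be the $n\times p$ matrix with $(i,j)$ entry $u_j(i)$, delete all rows whose entries are all equal, then replace each maximal block of consecutive identical rows by one copy, obtaining an $m'\times p$ matrix with columns $s_1,\dots,s_p\in A^{m'}$; $\tau(G)=\{s_1,\dots,s_p\}$ (independent of enumeration), of dimension $m'$. If $|G|=1$, $\tau(G)=\emptyset$. A process $\langle D_t:t\in A^n\rangle$ is $\eta$-stationary if for all nonempty $G_1,G_2\subseteq A^n$ with $\tau(G_1)=\tau(G_2)$, $\big|\mathbb{P}\big(\bigcap_{t\in G_1}D_t\big)-\mathbb{P}\big(\bigcap_{t\in G_2}D_t\big)\big|\leqslant\eta$. Local insensitivity: for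 $\alpha\neq\beta$ in $A$ and nonempty $I\subseteq[d]$, $t,s\in A^d$ are $(\alpha,\beta,I)$-equivalent if $t_i=s_i$ for every $i\in[d]\setminus I$ and, for every $i\in I$ and every $\gamma\in A\setminus\{\alpha,\beta\}$, $t_i=\gamma$ iff $s_i=\gamma$. A process $\langle E_t:t\in A^d\rangle$ is $(\alpha,\beta,I)$-insensitive if $E_t=E_s$ whenever $t,s$ are $(\alpha,\beta,I)$-equivalent. Simplicial processes: let $d\geqslant\ell$ be positive integers and $\mathbf{r}=(r_1,\dots,r_\ell)$ positive integers with $d=r_1+\cdots+r_\ell$, and let $I^{\mathbf{r}}_1,\dots,I^{\mathbf{r}}_\ell$ be the successive intervals of $[d]$ with $|I^{\mathbf{r}}_l|=r_l$. A process $\langle S_t:t\in A^d\rangle$ is $(\ell,\mathbf{r})$-simplicial if there exist $\beta_1,\dots,\beta_\ell\in A$, for each $l\in[\ell]$ a nonempty $\Gamma_l\subseteq A\setminus\{\beta_l\}$, and for each $l\in[\ell]$ and $\alpha\in\Gamma_l$ an $(\alpha,\beta_l,I^{\mathbf{r}}_l)$-insensitive process $\langle E^{l,\alpha}_t:t\in A^d\rangle$ of events, such that $S_t=\bigcap_{l=1}^\ell\bigcap_{\alpha\in\Gamma_l}E^{l,\alpha}_t$ for every $t\in A^d$. A process $\langle S_t:t\in V\rangle$ indexed by a $d$-dimensional combinatorial space $V$ is $(\ell,\mathbf{r})$-simplicial in $V$ if $\langle S_{\mathrm{I}_V(t)}:t\in A^d\rangle$ is $(\ell,\mathbf{r})$-simplicial.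 *)

(* Defs.v *)
From mathcomp Require Export all_boot all_order all_algebra.
From mathcomp Require Export all_classical all_reals all_analysis.

Set Implicit Arguments.
Unset Strict Implicit.
Unset Printing Implicit Defensive.

Export Order.TTheory GRing.Theory Num.Theory.

Local Open Scope classical_set_scope.
Local Open Scope ring_scope.

Section CombinatorialSpaces.
Variables (A : finType) (n d : nat).

(* [inl a] is the letter [a] and [inr j] is the variable x_j. *)
Definition variable_word (v : n.-tuple (A + 'I_d)) : Prop :=
  (forall j : 'I_d, inr j \in v) /\
  (forall (j1 j2 : 'I_d) (i1 i2 : 'I_n), (j1 < j2)%N ->
     tnth v i1 = inr j1 -> tnth v i2 = inr j2 -> (i1 < i2)%N).

Definition substitute (v : n.-tuple (A + 'I_d)) (a : d.-tuple A) : n.-tuple A :=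
  map_tuple (fun z => match z with inl x => x | inr j => tnth a j end) v.

(* A [d]-dimensional combinatorial subspace of A^n, carried by its generating
   word; when A has at least two letters the word is determined by the set
   [points V]. *)
Record comb_space := CombSpace {
  generator : n.-tuple (A + 'I_d);
  generatorP : variable_word generator }.

Definition canonical_iso (V : comb_space) : d.-tuple A -> n.-tuple A :=
  substitute (generator V).

Definition points (V : comb_space) : {set n.-tuple A} :=
  [set canonical_iso V a | a in [set: d.-tuple A]]%SET.

End CombinatorialSpaces.

Section Types.
Variables (A : finType) (n : nat).

(* The rows of the matrix with (i,j) entry u_j(i). *)
Definition word_rows p (u : p.-tuple (n.-tuple A)) : seq (p.-tuple A) :=
  [seq map_tuple (fun w : n.-tuple A => tnth w i) u | i <- enum 'I_n].

Fixpoint collapse (X : eqType) (s : seq X) : seq X :=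
  if s is x :: s' then
    if ohead s' == Some x then collapse s' else x :: collapse s'
  else [::].

Definition reduced_rows p (u : p.-tuple (n.-tuple A)) : seq (p.-tuple A) :=
  collapse [seq row : p.-tuple A <- word_rows u | ~~ constant row].

Definition columns p (rows : seq (p.-tuple A)) : seq (seq A) :=
  [seq [seq tnth row j | row : p.-tuple A <- rows] | j <- enum 'I_p].

Definition type_dim (G : {set n.-tuple A}) : nat :=
  size (reduced_rows (enum_tuple G)).

(* The elements of [type_of G] are words of length [type_dim G]; they are kept
   as sequences so that types of different dimensions can be compared. The case
   #|G| = 1 is separate because the reduced matrix then has no rows and its
   column would be the empty word. *)
Definition type_of (G : {set n.-tuple A}) : set (seq A) :=
  if #|G| == 1%N then set0 else [set` columns (reduced_rows (enum_tuple G))].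

End Types.

Section Processes.
Context (disp : measure_display) (T : measurableType disp) (R : realType).
Variable P : probability T R.

Definition prob (X : set T) : R := fine (P X).

Definition cond_prob (X Y : set T) : R := prob (X `&` Y) / prob Y.

Definition is_process (I : Type) (D : I -> set T) : Prop :=
  forall t, measurable (D t).

Definition stationary (A : finType) (n : nat) (eta : R)
    (D : n.-tuple A -> set T) : Prop :=
  forall G1 G2 : {set n.-tuple A}, G1 != finset.set0 -> G2 != finset.set0 ->
    type_of G1 = type_of G2 ->
    `|prob (\bigcap_(t in [set` G1]) D t) - prob (\bigcap_(t in [set` G2]) D t)|
      <= eta.

End Processes.

Section Simplicial.
Context (disp : measure_display) (T : measurableType disp) (A : finType).

Definition local_equiv (d : nat) (a b : A) (I : {set 'I_d})
    (t s : d.-tuple A) : Prop :=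
  (forall i, i \notin I -> tnth t i = tnth s i) /\
  (forall i, i \in I -> forall c : A, c != a -> c != b ->
     (tnth t i = c <-> tnth s i = c)).

Definition insensitive (d : nat) (a b : A) (I : {set 'I_d})
    (E : d.-tuple A -> set T) : Prop :=
  forall t s, local_equiv a b I t s -> E t = E s.

Definition block (l : nat) (r : 'I_l -> nat) (i : 'I_l) :
    {set 'I_(\sum_(j < l) r j)} :=
  [set x : 'I_(\sum_(j < l) r j) |
    (\sum_(j < l | (j < i)%N) r j <= x < \sum_(j < l | (j <= i)%N) r j)%N]%SET.

Definition simplicial (l : nat) (r : 'I_l -> nat)
    (S : (\sum_(j < l) r j).-tuple A -> set T) : Prop :=
  exists (b : 'I_l -> A) (Gamma : 'I_l -> {set A})
         (E : 'I_l -> A -> (\sum_(j < l) r j).-tuple A -> set T),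
    [/\ forall i, Gamma i != finset.set0 /\ b i \notin Gamma i,
        forall i a, a \in Gamma i ->
          is_process (E i a) /\ insensitive a (b i) (block r i) (E i a)
      & forall t, S t =
          \bigcap_(i in [set: 'I_l]) \bigcap_(a in [set` Gamma i]) E i a t].

(* Only the values of [S] on the points of [V] matter. *)
Definition simplicial_in (n l : nat) (r : 'I_l -> nat)
    (V : comb_space A n (\sum_(j < l) r j)) (S : n.-tuple A -> set T) : Prop :=
  simplicial (fun t => S (canonical_iso V t)).

End Simplicial.

(* Main.v *)
Require Import Defs.
From mathcomp Require Import ring lra.

Set Implicit Arguments.
Unset Strict Implicit.
Unset Printing Implicit Defensive.

(** If (i) fails, pick an inclusion-minimal F whose intersection deviates from
    eps^|F| by more than sigma 4^(|F| - kappa), and a word s in F. Spread F along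
    the reduced matrix of its type: after each row q put the block q of variables,
    and for t let the copy of j in F read t there, except that the letter
    beta_q = s(q) is replaced by j(q). These copies of F keep its type, the copy of
    s runs through a combinatorial space, and the copy of j is
    (j(q), beta_q)-insensitive on the block q. By minimality, the event of the
    copy of s correlates either with the intersection over the copies of the
    other words or, when the deviation is negative, with the same intersection
    where a single event is complemented. *)

Local Open Scope classical_set_scope.
Local Open Scope ring_scope.

(** * Reduced matrices and types *)

Section Collapse.
Variable X : eqType.
Implicit Types (x : X) (s : seq X).

Lemma ohead_collapse s : ohead (collapse s) = ohead s.
Proof. by elim: s => //= x s IHs; case: eqP => // hs; rewrite IHs. Qed.

Lemma mem_collapse s : collapse s =i s.
Proof.
elim: s => //= x s IHs y; case: eqP => hs; last by rewrite !inE IHs.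
rewrite IHs inE; case: eqP => //= ->.
by case: s hs {IHs} => //= z s [->]; rewrite mem_head.
Qed.

Lemma size_collapse s : (size (collapse s) <= size s)%N.
Proof.
by elim: s => //= x s IHs; case: ifP => _ //=; rewrite (leq_trans IHs).
Qed.

Lemma collapse_cons x s1 s2 :
  collapse s1 = collapse s2 -> collapse (x :: s1) = collapse (x :: s2).
Proof. by move=> e /=; rewrite -ohead_collapse e ohead_collapse. Qed.

End Collapse.

(** A letter is dropped only when it equals the next one; then its image passes [q] exactly when the
    next image does, and is dropped again. *)
Lemma collapse_map_filter (X Y : eqType) (f : X -> Y) (q : pred Y) (s : seq X) :
  collapse (seq.filter q (map f (collapse s))) = collapse (seq.filter q (map f s)).
Proof.
elim: s => // x s IHs.
rewrite [collapse (x :: s)]/= [map f (x :: s)]/= [seq.filter q (_ :: _)]/=.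
case: eqP => hs.
  rewrite IHs; case: ifP => // qx.
  by case: s hs {IHs} => //= y s [->]; rewrite qx /= eqxx.
rewrite [map f _]/= [seq.filter q (_ :: _)]/=.
by case: ifP => // _; apply: collapse_cons.
Qed.

Lemma collapse_idem (X : eqType) (s : seq X) : collapse (collapse s) = collapse s.
Proof.
by have := collapse_map_filter id predT s; rewrite !filter_predT !map_id.
Qed.

Lemma collapse_map_inj (X Y : eqType) (f : X -> Y) (s : seq X) :
  injective f -> collapse (map f s) = map f (collapse s).
Proof.
move=> finj; elim: s => //= x s ->.
have -> : (ohead (map f s) == Some (f x)) = (ohead s == Some x).
  by case: s => //= y s; apply/eqP/eqP => [[/finj ->]|[->]].
by case: ifP.
Qed.

(** The entries of [s1] that survive the filter equal [x] and merge into it. *)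
Lemma collapse_absorb (X : eqType) (q : pred X) x s1 s2 :
  {in s1, forall y, q y -> y = x} ->
  collapse (x :: seq.filter q (s1 ++ s2)) = collapse (x :: seq.filter q s2).
Proof.
elim: s1 => // y s1 IHs1 s1P.
have {}IHs1 : collapse (x :: seq.filter q (s1 ++ s2)) = collapse (x :: seq.filter q s2).
  by apply: IHs1 => z zs1; apply: s1P; rewrite inE zs1 orbT.
rewrite cat_cons [seq.filter _ _]/=; case: ifP => // qy.
have -> : y = x by apply: s1P => //; rewrite mem_head.
by rewrite -IHs1 [LHS]/= eqxx.
Qed.

Section Reduced.
Variables (A I : finType).
Implicit Types (row : {ffun I -> A}) (s : seq {ffun I -> A}).

Definition varying row : bool := [exists i, exists j, row i != row j].

(** Rows are indexed by an arbitrary finite type instead of the enumeration of a set, so that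
    passing to a subfamily is composition with a map. *)
Definition reduced s := collapse (seq.filter varying s).

Lemma varyingPn row : reflect (forall i j, row i = row j) (~~ varying row).
Proof.
rewrite negb_exists; apply: (iffP forallP) => h i.
  by move=> j; have := h i; rewrite negb_exists => /forallP/(_ j)/negPn/eqP.
by rewrite negb_exists; apply/forallP => j; rewrite (h i j) eqxx.
Qed.

Lemma mem_reduced s row : (row \in reduced s) = varying row && (row \in s).
Proof. by rewrite mem_collapse mem_filter. Qed.

End Reduced.

Lemma reduced_map (A I J : finType) (f : {ffun I -> A} -> {ffun J -> A}) s :
  (forall row, ~~ varying row -> ~~ varying (f row)) ->
  reduced (map f (reduced s)) = reduced (map f s).
Proof.
move=> fconst; rewrite /reduced collapse_map_filter; congr collapse.
elim: s => //= row s IHs; have [_|/fconst/negbTE fr] /= := boolP (varying row).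
  by rewrite IHs.
by rewrite fr IHs.
Qed.

Section Rows.
Variables (A : finType) (n : nat).

Definition rows (I : finType) (u : I -> n.-tuple A) : seq {ffun I -> A} :=
  [seq [ffun j => tnth (u j) i] | i <- enum 'I_n].

Definition restrict (I J : finType) (h : J -> I) (row : {ffun I -> A}) :
  {ffun J -> A} := [ffun j => row (h j)].

Lemma rows_comp (I J : finType) (h : J -> I) (u : I -> n.-tuple A) :
  rows (u \o h) = map (restrict h) (rows u).
Proof.
by rewrite /rows -map_comp; apply: eq_map => i; apply/ffunP => j; rewrite !ffunE.
Qed.

(** Constant rows stay constant under restriction. Hence the reduced matrix of a family determines
    those of all its subfamilies. *)
Lemma reduced_rows_comp (I J : finType) (h : J -> I) (u : I -> n.-tuple A) :
  reduced (rows (u \o h)) = reduced (map (restrict h) (reduced (rows u))).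
Proof.
rewrite rows_comp reduced_map // => row /varyingPn rowP.
by apply/varyingPn => i j; rewrite !ffunE.
Qed.

Lemma size_reduced (I : finType) (s : seq {ffun I -> A}) :
  (size (reduced s) <= size s)%N.
Proof.
by rewrite (leq_trans (size_collapse _)) // size_filter count_size.
Qed.

Lemma reduced_separates (I : finType) (u : I -> n.-tuple A) i j :
  u i != u j -> exists2 row, row \in reduced (rows u) & row i != row j.
Proof.
move=> uij; have [x xP] : exists x, tnth (u i) x != tnth (u j) x.
  apply/existsP; apply: contraNT uij; rewrite negb_exists => /forallP h.
  by apply/eqP/eq_from_tnth => x; apply/eqP; rewrite -[_ == _]negbK h.
exists [ffun j => tnth (u j) x]; last by rewrite !ffunE.
rewrite mem_reduced map_f ?mem_enum // andbT.
apply: contraNT xP => h.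
by have := varyingPn _ h i j; rewrite !ffunE => ->.
Qed.

Lemma constant_tnthP p (row : p.-tuple A) :
  reflect (forall i j, tnth row i = tnth row j) (constant row).
Proof.
apply: (iffP idP) => [|h].
  case: p row => [|p] row; first by move=> _ [].
  case/tupleP: row => x row /= /all_pred1P rE i j.
  by rewrite !(tnth_nth x) /= rE size_tuple -[_ :: _]/(nseq p.+1 x) !nth_nseq !ltn_ord.
case: p row h => [|p] row h; first by rewrite tuple0.
case/tupleP: row h => x row h /=; apply/allP => y /tnthP [i ->] /=.
by have := h (lift ord0 i) ord0; rewrite tnthS tnth0 => ->.
Qed.

(** Distinct words differ at a varying row. This settles the separate singleton case in
    [type_of]. *)
Lemma card_imset_reduced (I : finType) (u : I -> n.-tuple A) :
  (0 < #|I|)%N -> (#|u @: [set: I]%SET| == 1%N) = (reduced (rows u) == [::]).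
Proof.
case/card_gt0P => i0 _; apply/cards1P/eqP => [[x ux]|red0].
  have uE i : u i = x by apply/set1P; rewrite -ux imset_f.
  case E : (reduced _) => [//|row s].
  have := mem_head row s; rewrite -E mem_reduced => /andP[rowV /mapP[k _ rowE]].
  have /negP[//] : ~~ varying row.
  by apply/varyingPn => i j; rewrite rowE !ffunE !uE.
exists (u i0); apply/setP => x; rewrite !inE; apply/imsetP/eqP => [[i _ ->]|->]; last by exists i0.
apply/eqP/negP => /negP /reduced_separates [row]; by rewrite red0.
Qed.

(** This links [reduced] to the enumeration behind [type_of]. Surjectivity of [rk] makes the
    relabelling of rows injective and makes it respect constancy, even if [u] repeats words. *)
Lemma reduced_rows_imset (I : finType) (u : I -> n.-tuple A)
    (G := u @: [set: I]%SET) :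
  exists2 rk : I -> 'I_#|G|, (forall q, exists j, rk j = q) &
    reduced (rows u) = [seq [ffun j => tnth row (rk j)]
                       | row : #|G|.-tuple A <- reduced_rows (enum_tuple G)].
Proof.
have uG j : u j \in G by rewrite imset_f.
pose rk j := enum_rank_in (uG j) (u j).
have rkK j : enum_val (rk j) = u j by rewrite enum_rankK_in.
have rk_onto q : exists j, rk j = q.
  have /imsetP [j _ qj] : enum_val q \in G by apply: enum_valP.
  by exists j; apply: enum_val_inj; rewrite rkK.
exists rk => //.
set g := (X in map X _).
have g_inj : injective g.
  move=> x y /ffunP exy; apply: eq_from_tnth => q.
  by have [j <-] := rk_onto q; have := exy j; rewrite !ffunE.
have gP row : varying (g row) = ~~ constant row.
  suff -> : constant row = ~~ varying (g row) by rewrite negbK.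
  apply/constant_tnthP/varyingPn => h p q; first by rewrite !ffunE.
  have [i <-] := rk_onto p; have [j <-] := rk_onto q.
  by have := h i j; rewrite !ffunE.
have rowsE : rows u = map g (word_rows (enum_tuple G)).
  rewrite /word_rows -map_comp; apply: eq_map => i; apply/ffunP => j.
  rewrite !ffunE tnth_map; congr tnth.
  by rewrite -rkK /enum_val [RHS](tnth_nth (enum_default (rk j))).
rewrite /reduced /reduced_rows -collapse_map_inj // rowsE filter_map.
by congr (collapse (map _ _)); apply: eq_filter => row /=; rewrite gP.
Qed.

Lemma columns_imset (I : finType) (u : I -> n.-tuple A) :
  [set` columns (reduced_rows (enum_tuple (u @: [set: I]%SET)))] =
  [set s | exists j, s = [seq row j | row : {ffun I -> A} <- reduced (rows u)]].
Proof.
have [rk rk_onto ->] := reduced_rows_imset u.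
apply/seteqP; split => s /=.
  move=> /mapP [q _ ->]; have [j <-] := rk_onto q; exists j.
  by rewrite -map_comp; apply: eq_map => row; rewrite /= ffunE.
move=> [j ->]; apply/mapP; exists (rk j); rewrite ?mem_enum //.
by rewrite -map_comp; apply: eq_map => row; rewrite /= ffunE.
Qed.

(** Equality of reduced matrices restricts to [J], and the type is read off the reduced matrix. *)
Lemma type_of_imset (I : finType) (u w : I -> n.-tuple A) (J : {set I}) :
  J != finset.set0 -> reduced (rows u) = reduced (rows w) ->
  type_of (u @: J) = type_of (w @: J).
Proof.
move=> /set0Pn [j0 j0J] uw.
have imE (f : I -> n.-tuple A) :
    f @: J = (f \o (val : {j | j \in J} -> I)) @: [set: {j | j \in J}]%SET.
  apply/setP => x; apply/imsetP/imsetP => [[j jJ ->]|[j _ ->]].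
    by exists (Sub j jJ).
  by exists (val j) => //; apply: valP.
have I0 : (0 < #|{: {j | j \in J}}|)%N by apply/card_gt0P; exists (Sub j0 j0J).
rewrite (imE u) (imE w) /type_of !card_imset_reduced // !columns_imset.
by rewrite (reduced_rows_comp val u) (reduced_rows_comp val w) uw.
Qed.

(** Deleting columns of the reduced matrix of [G] and reducing again can only lose rows. *)
Lemma size_reduced_subset (F G : {set n.-tuple A}) : F \subset G ->
  (size (reduced (rows (val : {x | x \in F} -> n.-tuple A))) <= type_dim G)%N.
Proof.
move=> /fintype.subsetP FG; pose vG : {x | x \in G} -> n.-tuple A := val.
have GE : vG @: [set: {x | x \in G}]%SET = G.
  apply/setP => x; apply/imsetP/idP => [[y _ ->]|xG]; first exact: valP.
  by exists (Sub x xG).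
have -> : type_dim G = size (reduced (rows vG)).
  by have [rk _ ->] := reduced_rows_imset vG; rewrite size_map GE.
pose h (x : {x | x \in F}) : {x | x \in G} := Sub (val x) (FG _ (valP x)).
have -> : (val : {x | x \in F} -> n.-tuple A) = vG \o h by apply/funext => x.
by rewrite reduced_rows_comp (leq_trans (size_reduced _)) // size_map.
Qed.

End Rows.

(** * Copies of a family of words along a combinatorial space *)

Lemma block_lt l (r : 'I_l -> nat) (i j : 'I_l) x y :
  (i < j)%N -> x \in block r i -> y \in block r j -> (x < y)%N.
Proof.
rewrite !inE => ij /andP[_ xi] /andP[jy _].
apply: leq_trans xi (leq_trans _ jy).
rewrite [leqRHS](bigID (fun q : 'I_l => q <= i)%N) /= -[leqLHS]addn0 leq_add //.
rewrite (eq_bigl (fun q : 'I_l => (q < j)%N && (q <= i)%N)) // => q.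
by case: (leqP q i) => qi; rewrite ?andbF // (leq_ltn_trans qi ij).
Qed.

(** The block is the first one whose right end exceeds [x]. *)
Lemma block_exists l (r : 'I_l -> nat) (x : 'I_(\sum_(j < l) r j)) :
  exists i, x \in block r i.
Proof.
case: l r x => [|l] r x; first by exfalso; case: x => x; rewrite big_ord0.
have xmax : (x < \sum_(j < l.+1 | (j <= @ord_max l)%N) r j)%N.
  rewrite (leq_trans (ltn_ord x)) // [leqRHS](eq_bigl xpredT) //.
  by move=> j; rewrite leq_ord.
have [i xi imin] := @arg_minnP _ ord_max
  (fun i : 'I_l.+1 => x < \sum_(j < l.+1 | (j <= i)%N) r j)%N val xmax.
exists i; rewrite inE xi andbT.
case: (posnP i) => [i0|i_gt0]; first by rewrite big_pred0 // => j; rewrite i0.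
have i'P : (i.-1 < l.+1)%N by rewrite (leq_ltn_trans (leq_pred i)).
rewrite leqNgt; apply/negP => xlt.
suff /imin /= : (x < \sum_(j < l.+1 | (j <= Ordinal i'P)%N) r j)%N.
  by rewrite -ltnS prednK // ltnn.
(* The left end of block [i] is the right end of the block before it. *)
apply: leq_trans xlt _; rewrite leq_eqVlt; apply/orP; left; apply/eqP.
by apply: eq_bigl => j; rewrite -[X in (_ < X)%N](prednK i_gt0) ltnS.
Qed.

Lemma pairwise_flatten (T S : Type) (lt : rel S) (e : rel T) (f : S -> seq T) s :
  pairwise lt s -> (forall i, pairwise e (f i)) ->
  (forall i j, lt i j -> allrel e (f i) (f j)) ->
  pairwise e (flatten (map f s)).
Proof.
move=> + fi fij; elim: s => //= i s IHs /andP[lt_i /IHs ps].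
rewrite pairwise_cat fi ps !andbT; elim: s lt_i {IHs ps} => [|j s IHs] /=.
  by rewrite allrel0r.
by rewrite allrel_catr => /andP[/fij -> /IHs ->].
Qed.

Lemma pairwise_enum_ord p : pairwise (fun i j : 'I_p => (i < j)%N) (enum 'I_p).
Proof.
have := iota_ltn_sorted 0 p; rewrite sorted_pairwise; last exact: ltn_trans.
by rewrite -val_enum_ord pairwise_map.
Qed.

Section Template.
Variables (A I : finType) (l : nat) (rho : l.-tuple {ffun I -> A}).
Variables (r : 'I_l -> nat) (s : I) (a0 : A) (n : nat).
Local Notation d := (\sum_(j < l) r j)%N.
Hypothesis ldn : (l + d <= n)%N.

Definition block_of (x : 'I_d) : 'I_l := xchoose (block_exists x).

Lemma block_ofP q x : (x \in block r q) = (block_of x == q).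
Proof.
have xB : x \in block r (block_of x) by exact: xchooseP (block_exists x).
apply/idP/eqP => [xq|<- //]; apply/eqP; rewrite -[_ == _]/(val _ == val _).
case: ltngtP => // h; have := block_lt h;
  [move/(_ _ _ _ xB xq)|move/(_ _ _ _ xq xB)]; by rewrite ltnn.
Qed.

(* A pair [(row, None)] stands for a coordinate at which the copies of the words
   read [row], a pair [(row, Some x)] for one occupied by the variable x. *)
Definition template_block (q : 'I_l) : seq ({ffun I -> A} * option 'I_d) :=
  (tnth rho q, None) ::
  [seq (tnth rho q, Some x) | x <- enum 'I_d & block_of x == q].

(** Each block has one fixed row besides its variables, [l + d] entries in all; the constant rows at
    the end bring the length to [n] and vanish on reduction. *)
Definition template : seq ({ffun I -> A} * option 'I_d) :=
  flatten [seq template_block q | q <- enum 'I_l] ++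
  nseq (n - (l + d)) ([ffun=> a0], None).

Lemma size_template : size template == n.
Proof.
rewrite size_cat size_nseq size_flatten /shape -map_comp sumnE big_map big_enum.
rewrite /= (eq_bigr (fun q => 1 + \sum_(x < d | block_of x == q) 1)%N); last first.
  move=> q _; rewrite /= size_map size_filter -sum1_count add1n; congr S.
  by rewrite big_enum_cond.
rewrite big_split /= sum_nat_const card_ord muln1.
suff -> : (\sum_(q < l) \sum_(x < d | block_of x == q) 1 = d)%N by rewrite subnKC.
transitivity (\sum_(x < d) 1)%N; last by rewrite sum1_card card_ord.
by rewrite (partition_big block_of xpredT).
Qed.

Definition template_tuple := Tuple size_template.

Definition copy (j : I) (t : d.-tuple A) : n.-tuple A :=
  map_tuple (fun z : {ffun I -> A} * option 'I_d =>
    if z.2 is Some x then (if tnth t x == z.1 s then z.1 j else tnth t x)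
    else z.1 j) template_tuple.

Definition copy_word : n.-tuple (A + 'I_d) :=
  map_tuple (fun z : {ffun I -> A} * option 'I_d =>
    if z.2 is Some x then inr x else inl (z.1 s)) template_tuple.

Lemma mem_template z : z \in template ->
  [\/ z = ([ffun=> a0], None), exists q, z = (tnth rho q, None) |
    exists x, z = (tnth rho (block_of x), Some x)].
Proof.
rewrite mem_cat => /orP[/flatten_mapP[q _]|/nseqP[-> _]]; last by constructor 1.
rewrite inE => /orP[/eqP ->|/mapP[x]]; first by constructor 2; exists q.
by rewrite mem_filter => /andP[/eqP <- _ ->]; constructor 3; exists x.
Qed.

Lemma template_ordered :
  pairwise (fun y z : {ffun I -> A} * option 'I_d =>
    if (y.2, z.2) is (Some x1, Some x2) then (x1 < x2)%N else true) template.
Proof.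
set e := (X in pairwise X _).
have e_None (y z : {ffun I -> A} * option 'I_d) : z.2 = None -> e y z.
  by rewrite /e => ->; case: y.2.
rewrite /template pairwise_cat; apply/and3P; split.
- by apply/allrelP => y z _ /nseqP[-> _]; apply: e_None.
- apply: pairwise_flatten (pairwise_enum_ord l) _ _ => [q|i j ij].
    rewrite /template_block /= pairwise_map; apply/andP; split.
      by apply/allP.
    apply: (subseq_pairwise (filter_subseq _ _)).
    exact: pairwise_enum_ord.
  apply/allrelP => y z; rewrite !inE.
  case/orP => [/eqP -> _ //|/mapP[x1 + ->]].
  rewrite mem_filter -block_ofP => /andP[x1i _].
  case/orP => [/eqP -> //|/mapP[x2 + ->]].
  rewrite mem_filter -block_ofP => /andP[x2j _].
  exact: block_lt ij x1i x2j.
- elim: (n - _)%N => //= p ->; rewrite andbT.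
  by apply/allP => z /nseqP[-> _].
Qed.

Lemma copy_wordP : variable_word copy_word.
Proof.
split=> [x|x1 x2 i1 i2 x12].
  apply/mapP; exists (tnth rho (block_of x), Some x) => //.
  rewrite mem_cat; apply/orP; left; apply/flatten_mapP.
  exists (block_of x); rewrite ?mem_enum // inE; apply/orP; right.
  by apply/mapP; exists x => //; rewrite mem_filter eqxx mem_enum.
pose z0 : {ffun I -> A} * option 'I_d := ([ffun=> a0], None).
have SomeE i x : tnth copy_word i = inr x -> (nth z0 template i).2 = Some x.
  rewrite tnth_map (tnth_nth z0) /=.
  by case: (nth z0 template i) => row [y|] //= [->].
move=> /SomeE e1 /SomeE e2; case: (ltngtP i1 i2) => // [i21|/ord_inj i12].
  have /(pairwiseP z0)/(_ i2 i1) := template_ordered.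
  rewrite !inE (eqP size_template) !ltn_ord e1 e2 => /(_ isT isT i21).
  by rewrite ltnNge (ltnW x12).
by move: e2; rewrite -i12 e1 => -[e]; rewrite e ltnn in x12.
Qed.

(** For the copy of [s], the letter of [s] is replaced by itself, so variables are read
    unchanged. *)
Lemma copy_special t : copy s t = substitute copy_word t.
Proof.
apply: eq_from_tnth => i; rewrite !tnth_map.
by case: (tnth template_tuple i) => row [x|] //=; case: eqP.
Qed.

(** On block [q] the copy of [j] reads [tnth rho q j] both where [t] has that letter and where [t]
    has [tnth rho q s], so exchanging the two is invisible. If they coincide, the equivalence is
    equality. *)
Lemma copy_insensitive j q t t' :
  local_equiv (tnth rho q j) (tnth rho q s) (block r q) t t' ->
  copy j t = copy j t'.
Proof.
move=> [tout tin]; apply: val_inj; apply/eq_in_map => z /mem_template [->|[q' ->]|[x ->]] //=.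
have [|xq] := boolP (x \in block r q); last by rewrite tout.
move=> xq; have := tin _ xq; move: (xq); rewrite block_ofP => /eqP -> {}tin.
have [tx|tx] := eqVneq (tnth t x) (tnth rho q s);
  have [t'x|t'x] := eqVneq (tnth t' x) (tnth rho q s) => //.
- have [//|t'j] := eqVneq (tnth t' x) (tnth rho q j).
  by have /(_ erefl) := (tin _ t'j t'x).2; rewrite tx => /esym /eqP; rewrite (negbTE t'x).
- have [//|tj] := eqVneq (tnth t x) (tnth rho q j).
  by have /(_ erefl) := (tin _ tj tx).1; rewrite t'x => /esym /eqP; rewrite (negbTE tx).
have [tj|tj] := eqVneq (tnth t x) (tnth rho q j).
  have [//|t'j] := eqVneq (tnth t' x) (tnth rho q j).
    by rewrite tj.
  by have /(_ erefl) := (tin _ t'j t'x).2 => e.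
by have /(_ erefl) := (tin _ tj tx).1.
Qed.

(** At a variable of block [q] the copies read the row [tnth rho q] if [t] has the letter of [s]
    there, and a constant row otherwise. The former merge into the leading row of the block, which
    is present for every [t]; the latter are deleted. *)
Lemma reduced_copy t : all (@varying A I) rho ->
  reduced (rows (copy^~ t)) = collapse rho.
Proof.
move=> rhoV; pose F (z : {ffun I -> A} * option 'I_d) : {ffun I -> A} :=
  if z.2 is Some x then
    (if tnth t x == z.1 s then z.1 else [ffun=> tnth t x])
  else z.1.
have -> : rows (copy^~ t) = map F template.
  rewrite -[template]/(tval template_tuple) -[X in map F X]map_tnth_enum -map_comp.
  apply: eq_map => i; apply/ffunP => j; rewrite ffunE tnth_map /= /F.
  case: (tnth template_tuple i) => row [x|] //=.
  by case: ifP => // _; rewrite ffunE.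
have constV a : varying ([ffun=> a] : {ffun I -> A}) = false.
  by apply/negbTE/varyingPn => i j; rewrite !ffunE.
rewrite /template map_cat map_nseq /reduced filter_cat [F (_, None)]/=.
have -> : seq.filter (@varying A I) (nseq (n - (l + d)) [ffun=> a0]) = [::].
  by elim: (n - _)%N => //= p ->; rewrite constV.
rewrite cats0 -[in RHS](map_tnth_enum rho).
elim: (enum 'I_l) => // q qs IHqs.
rewrite -[flatten _]/((tnth rho q, None) ::
  (behead (template_block q) ++ flatten [seq template_block i | i <- qs])).
rewrite map_cons map_cat.
have qV : varying (tnth rho q) by apply: (allP rhoV); apply: mem_tnth.
transitivity (collapse (tnth rho q :: seq.filter (@varying A I)
  (map F (behead (template_block q)) ++
   map F (flatten [seq template_block i | i <- qs])))).
  by congr collapse; rewrite /= qV.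
rewrite collapse_absorb; last first.
  move=> _ /mapP[_ /mapP[x _ ->] ->]; rewrite /F /=; case: ifP => // _.
  by rewrite constV.
by rewrite [map _ (q :: qs)]/=; apply: collapse_cons.
Qed.

End Template.

(** * Simplicial processes and numerical estimates *)

Lemma canonical_iso_inj (A : finType) n d (V : comb_space A n d) :
  injective (canonical_iso V).
Proof.
move=> a b ab; apply: eq_from_tnth => j.
have /tnthP [i jE] := (generatorP V).1 j.
by have := congr1 (fun w => tnth w i) ab; rewrite !tnth_map -jE.
Qed.

Section Simplicial.
Context (disp : measure_display) (T : measurableType disp) (A I : finType).

(* Every letter other than beta_i is put in Gamma_i; the process attached to a
   letter that no word takes at i is constantly the whole space. *)
Lemma simplicial_bigcap l (r : 'I_l -> nat) (rho : 'I_l -> I -> A) (s : I)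
    (X : I -> (\sum_(i < l) r i).-tuple A -> set T) :
  (2 <= #|A|)%N -> (forall j, is_process (X j)) ->
  (forall j, j != s -> exists i, rho i j != rho i s) ->
  (forall i j, insensitive (rho i j) (rho i s) (block r i) (X j)) ->
  simplicial (fun t => \bigcap_(j in [set j | j != s]) X j t).
Proof.
move=> A2 Xm sep Xins.
exists (fun i => rho i s), (fun i => [set~ rho i s]%SET).
exists (fun i a t => \bigcap_(j in [set j | j != s /\ rho i j = a]) X j t).
split=> [i|i a _|t]; first split.
- by rewrite -card_gt0 cardsC1; case: #|A| A2 => [|[]].
- by rewrite !inE eqxx.
- split=> [t|t t' tt']; last first.
    by apply: eq_bigcapr => j [_ ja]; apply: (Xins i); rewrite ja.
  by apply: fin_bigcap_measurable => [|j _]; [exact: finite_finset|exact: Xm].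
apply/seteqP; split=> x xX.
  by move=> i _ a _ j [js _]; apply: xX.
move=> j js; have [i ij] := sep j js.
by apply: (xX i _ (rho i j)) => //=; rewrite !inE.
Qed.

(** Distinct parameters give distinct points, so a process on parameters can be carried to
    [points V]; the value [set0] elsewhere is never seen. *)
Lemma simplicial_in_extend n l (r : 'I_l -> nat)
    (V : comb_space A n (\sum_(i < l) r i))
    (S : (\sum_(i < l) r i).-tuple A -> set T) :
  simplicial S ->
  exists2 S' : n.-tuple A -> set T, simplicial_in V S' &
    forall t, S' (canonical_iso V t) = S t.
Proof.
move=> Ss.
pose S' x := if [pick t | canonical_iso V t == x] is Some t then S t else set0.
have S'E t : S' (canonical_iso V t) = S t.
  rewrite /S'; case: pickP => [t' /eqP /canonical_iso_inj -> //|/(_ t)].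
  by rewrite eqxx.
by exists S' => //; rewrite /simplicial_in (_ : (fun t => _) = S) //; apply/funext.
Qed.

End Simplicial.

(** Here [y] is a power of [eps], [a] the probability of the conditioning event, and [f] that of its
    intersection with the event of [s]. The excess [f - eps * a] is at least [4 * X - delta - e],
    hence at least [delta], and [a <= 1]. *)
Lemma increment_above (R : realFieldType) (eps delta X M y e a f : R) :
  0 < eps <= 1 -> 0 < delta <= X -> 2 * X <= M -> e <= 2 * X ->
  2 * M <= eps * y -> `|a - eps * y| <= e -> a <= 1 ->
  eps * (eps * y) + 4 * X - delta <= f ->
  M <= a /\ eps + delta <= f / a.
Proof.
move=> /andP[eps_gt0 eps_le1] /andP[delta_gt0 deltaX] XM eX My.
rewrite ler_norml => /andP[a_ge a_le] a_le1 f_ge.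
have Ma : M <= a by lra.
split=> //; rewrite ler_pdivlMr; last by lra.
have : delta * a <= delta by rewrite ler_piMr // ltW.
have e_ge0 : 0 <= e by lra.
have : eps * (a - eps * y) <= e by nra.
lra.
Qed.

(** With one event complemented, the two probabilities are [b - a] and [g - f]. The first is
    [y * (1 - eps)] up to [e0 + e1], the second at least [eps * y * (1 - eps) + 4 * X - delta - e1].
    The errors add up to at most [e0 + 2 * e1], which leaves a gain of [delta]. *)
Lemma increment_below (R : realFieldType) (eps delta X M y e0 e1 a b f g : R) :
  0 < eps <= 1 -> 0 < delta -> 0 < M -> 2 * X <= M -> 0 <= e0 ->
  e0 + e1 <= 2 * X -> e0 + 2 * e1 + 2 * delta <= 4 * X ->
  2 * M <= y * (1 - eps) ->
  `|a - eps * y| <= e1 -> `|b - y| <= e0 -> `|g - eps * y| <= e1 ->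
  b - a <= 1 -> f <= eps * (eps * y) - 4 * X + delta ->
  M <= b - a /\ eps + delta <= (g - f) / (b - a).
Proof.
move=> /andP[eps_gt0 eps_le1] delta_gt0 M_gt0 XM e0_ge0 e01 e01' My.
rewrite !ler_norml => /andP[a_ge a_le] /andP[b_ge b_le] /andP[g_ge g_le] ba1 f_le.
have Mba : M <= b - a by lra.
split=> //; rewrite ler_pdivlMr; last by lra.
have : delta * (b - a) <= delta by rewrite ler_piMr // ltW.
have e1_ge0 : 0 <= e1 by lra.
have : eps * (b - y) <= e0 by nra.
have : - e1 <= eps * (a - eps * y) by nra.
lra.
Qed.

(** * Density increment *)

Lemma bigcap_imset (I J : finType) (T : Type) (f : I -> J) (B : {set I})
    (F : J -> set T) :
  \bigcap_(j in [set` (f @: B)%SET]) F j = \bigcap_(i in [set` B]) F (f i).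
Proof.
apply/seteqP; split=> x xF; first by move=> i iB; apply: xF; apply: imset_f.
by move=> _ /imsetP[i iB ->]; apply: xF.
Qed.

Lemma bigcap_setD1 (I : finType) (T : Type) (i : I) (B : {set I})
    (F : I -> set T) : i \in B ->
  \bigcap_(j in [set` B]) F j = F i `&` \bigcap_(j in [set` (B :\ i)%SET]) F j.
Proof.
move=> iB; rewrite -bigcap_setU1; congr bigcap; apply/seteqP; split=> j /=.
  by move=> jB; have [->|ji] := eqVneq j i; [left|right; rewrite in_setD1 ji].
by case=> [->//|]; rewrite in_setD1 => /andP[].
Qed.

Section Probability.
Context (disp : measure_display) (T : measurableType disp) (R : realType).
Variable P : probability T R.

Lemma prob_setT : prob P setT = 1.
Proof. by rewrite /prob probability_setT. Qed.

Lemma prob_le1 X : measurable X -> prob P X <= 1.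
Proof.
by move=> mX; rewrite /prob -lee_fin fineK ?probability_le1 ?fin_num_measure.
Qed.

Lemma prob_setCI X Y : measurable X -> measurable Y ->
  prob P (~` X `&` Y) = prob P Y - prob P (X `&` Y).
Proof.
move=> mX mY; rewrite /prob (measureDI P mY mX) setIC -setDE setIC.
rewrite fineD ?fin_num_measure ?addrK //; [exact: measurableD|exact: measurableI].
Qed.

End Probability.

Section Copies.
Context (R : realType) (disp : measure_display) (T : measurableType disp).
Context (P : probability T R) (A : finType) (n : nat).
Variables (eps delta eta : R) (D : n.-tuple A -> set T).
Hypotheses (hD : is_process D) (D_stat : stationary P eta D).
Hypotheses (D_eps : forall t, `|prob P (D t) - eps| <= eta).
Hypothesis eta_le : eta <= delta.

(* The error eta of stationarity is not paid for at most one word; without this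
   the increment for a pair of words would be lost. *)
Definition deviation k : R :=
  match k with 0 => 0 | 1 => delta | k'.+2 => delta * 4 ^+ k'.+1 + delta end.

(** Stationarity carries the bound from [u] to [w] at cost [eta <= delta]; a single word is covered
    by [D_eps] and no word by [prob_setT]. *)
Lemma deviation_copy (I : finType) (u w : I -> n.-tuple A) (J : {set I}) :
  reduced (rows w) = reduced (rows u) ->
  `|prob P (\bigcap_(j in [set` J]) D (u j)) - eps ^+ #|J| |
    <= delta * 4 ^+ (#|J|.-1) ->
  `|prob P (\bigcap_(j in [set` J]) D (w j)) - eps ^+ #|J| | <= deviation #|J|.
Proof.
move=> wu uJ; case cJ: #|J| uJ => [|[|k]] uJ.
- move/eqP: cJ; rewrite cards_eq0 => /eqP ->.
  rewrite (_ : [set` _] = set0); last by apply/seteqP; split=> x //=; rewrite inE.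
  by rewrite bigcap_set0 prob_setT expr0 subrr normr0.
- move/eqP: cJ => /cards1P[j ->].
  rewrite (_ : [set` _] = [set j]); last by apply/seteqP; split=> x /=; rewrite inE => /eqP.
  by rewrite bigcap_set1 expr1 (le_trans (D_eps _)).
have J0 : J != finset.set0 by rewrite -card_gt0 cJ.
have imJ0 (f : I -> n.-tuple A) : f @: J != finset.set0.
  by rewrite imset_eq0.
have := D_stat (imJ0 w) (imJ0 u) (type_of_imset J0 wu).
rewrite !bigcap_imset => h.
apply: le_trans (lerD uJ (le_trans h eta_le)).
by rewrite [leRHS]addrC; apply: ler_distD.
Qed.

(** These are the error conditions of the two increment lemmas. For [q = 0], a pair of words, the
    third is an equality. *)
Lemma deviation_bounds q : 0 < delta ->
  [/\ deviation q.+1 <= 2 * (delta * 4 ^+ q),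
      deviation q + deviation q.+1 <= 2 * (delta * 4 ^+ q),
      deviation q + 2 * deviation q.+1 + 2 * delta <= 4 * (delta * 4 ^+ q)
    & 0 <= deviation q].
Proof.
move=> delta_gt0; case: q => [|[|q]] /=.
- by rewrite expr0; split; lra.
- by rewrite expr1; split; lra.
have : delta <= delta * 4 ^+ q.
  by apply: ler_peMr; [exact: ltW|apply: exprn_ege1; rewrite ler1n].
rewrite !exprS; set Y := 4 ^+ q; move: delta_gt0 => + h.
by split; lra.
Qed.

Lemma full_copy (I : finType) (u w : I -> n.-tuple A) :
  (0 < #|I|)%N -> reduced (rows w) = reduced (rows u) ->
  `|prob P (\bigcap_(j in [set: I]) D (w j)) -
    prob P (\bigcap_(j in [set: I]) D (u j))| <= delta.
Proof.
move=> I0 wu.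
have J0 : [set: I]%SET != finset.set0 by rewrite -card_gt0 cardsT.
have imJ0 (f : I -> n.-tuple A) : f @: [set: I]%SET != finset.set0.
  by rewrite imset_eq0.
have := D_stat (imJ0 w) (imJ0 u) (type_of_imset J0 wu).
rewrite !bigcap_imset (_ : [set` _] = [set: I]); last first.
  by apply/seteqP; split=> x //=; rewrite inE.
by move=> h; apply: le_trans eta_le.
Qed.

Variables (I : finType) (u : I -> n.-tuple A) (q : nat) (M : R).
Hypotheses (A_ge2 : (2 <= #|A|)%N) (u_inj : injective u) (cardI : #|I| = q.+2).
Hypothesis sub_dev : forall J : {set I}, J != [set: I]%SET ->
  `|prob P (\bigcap_(j in [set` J]) D (u j)) - eps ^+ #|J| |
    <= delta * 4 ^+ (#|J|.-1).
Hypothesis full_dev : delta * 4 ^+ q.+1 <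
  `|prob P (\bigcap_(j in [set: I]) D (u j)) - eps ^+ q.+2|.
Hypotheses (eps01 : 0 < eps <= 1) (delta_gt0 : 0 < delta) (M_gt0 : 0 < M).
Hypotheses (deltaM : 2 * (delta * 4 ^+ q) <= M) (M_le : 2 * M <= eps ^+ q.+1)
  (M_le' : 2 * M <= eps ^+ q * (1 - eps)).

Lemma simplicial_increment (l := size (reduced (rows u))) (r : 'I_l -> nat) :
  (l + \sum_(i < l) r i <= n)%N ->
  exists (V : comb_space A n (\sum_(i < l) r i)) (S : n.-tuple A -> set T),
    simplicial_in V S /\
    forall t, t \in points V ->
      M <= prob P (S t) /\ eps + delta <= cond_prob P (D t) (S t).
Proof.
move=> ldn; pose rho : l.-tuple _ := in_tuple (reduced (rows u)).
have [s [j0 [_ _ sj0]]] : exists s j0, [/\ s \in I, j0 \in I & s != j0].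
  by apply/card_gt1P; rewrite cardI.
have [a0 _] : exists a0, a0 \in A by apply/card_gt0P; apply: ltnW.
pose w := copy rho s a0 ldn.
have rhoV : all (@varying A I) rho.
  by apply/allP => row; rewrite mem_reduced => /andP[].
have w_red t : reduced (rows (w^~ t)) = reduced (rows u).
  by rewrite reduced_copy //= collapse_idem.
pose V := CombSpace (copy_wordP rho s a0 ldn).
have VE t : canonical_iso V t = w s t by rewrite /w copy_special.
pose pr (J : {set I}) t := prob P (\bigcap_(j in [set` J]) D (w j t)).
have wdev J t : J != [set: I]%SET ->
    `|pr J t - eps ^+ #|J| | <= deviation #|J|.
  by move=> JT; apply: deviation_copy (w_red t) (sub_dev JT).
have I_gt0 : (0 < #|I|)%N by rewrite cardI.
have wfull t := full_copy I_gt0 (w_red t).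
pose full t := \bigcap_(j in [set: I]) D (w j t).
(* For a pair of words [B] is empty and [capB t] is the whole space. *)
pose B := ([set: I] :\ s :\ j0)%SET; pose capB t := \bigcap_(j in [set` B]) D (w j t).
have cardD1 j : #|([set: I] :\ j)%SET| = q.+1.
  by have := cardsD1 j [set: I]%SET; rewrite inE cardsT cardI add1n => -[].
have js_in : j0 \in ([set: I] :\ s)%SET by rewrite !inE eq_sym sj0.
have cardB : #|B| = q.
  by have := cardsD1 j0 ([set: I] :\ s)%SET; rewrite js_in cardD1 add1n => -[].
have neT j : ([set: I] :\ j)%SET != [set: I]%SET.
  apply/eqP => e; have /eqP := cardD1 j.
  by rewrite e cardsT cardI eqn_leq ltnn.
have BneT : B != [set: I]%SET.
  apply/eqP => e; have /eqP := cardB.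
  by rewrite e cardsT cardI eqn_leq ltnNge leqnSn.
have BE t : \bigcap_(j in [set` ([set: I] :\ s)%SET]) D (w j t) = D (w j0 t) `&` capB t.
  exact: bigcap_setD1.
have BE' t : \bigcap_(j in [set` ([set: I] :\ j0)%SET]) D (w j t) = D (w s t) `&` capB t.
  rewrite (@bigcap_setD1 _ _ s) ?inE ?sj0 // /capB /B.
  by rewrite !finset.setDDl [X in _ :\: X]finset.setUC.
have fullE t : full t = D (w s t) `&` (D (w j0 t) `&` capB t).
  rewrite -BE -(@bigcap_setD1 _ _ s _ (fun j => D (w j t))) ?inE // /full.
  by congr bigcap; apply/seteqP; split=> x //=; rewrite inE.
have mB t : measurable (capB t).
  by apply: fin_bigcap_measurable => [|j _]; [exact: finite_finset|exact: hD].
have mD j t : measurable (D (w j t)) by apply: hD.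
(* The Boolean [c] tells whether the event of [j0] is complemented; this preserves insensitivity. *)
pose X c j t := if c && (j == j0) then ~` D (w j t) else D (w j t).
have XE c t : \bigcap_(j in [set j | j != s]) X c j t =
    (if c then ~` D (w j0 t) else D (w j0 t)) `&` capB t.
  rewrite (_ : [set j | j != s] = [set` ([set: I] :\ s)%SET]); last first.
    by apply/seteqP; split=> j /=; rewrite !inE andbT.
  rewrite (bigcap_setD1 _ js_in) /X eqxx andbT; congr setI.
  by apply: eq_bigcapr => j /=; rewrite in_setD1 => /andP[/negbTE -> _]; rewrite andbF.
(* One [c] must serve all [t]. It is given by the sign of the deviation of the original family [u],
   from which the copies differ by at most [delta]. *)
have [c cP] : exists c, forall t,
    M <= prob P ((if c then ~` D (w j0 t) else D (w j0 t)) `&` capB t) /\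
    eps + delta <= cond_prob P (D (w s t))
      ((if c then ~` D (w j0 t) else D (w j0 t)) `&` capB t).
  have [dev_hi dev_sum0 dev_sum dev0] : [/\ deviation q.+1 <= 2 * (delta * 4 ^+ q),
      deviation q + deviation q.+1 <= 2 * (delta * 4 ^+ q),
      deviation q + 2 * deviation q.+1 + 2 * delta <= 4 * (delta * 4 ^+ q)
      & 0 <= deviation q].
    exact: deviation_bounds.
  have X_ge : 0 < delta <= delta * 4 ^+ q.
    rewrite delta_gt0 /=.
    by apply: ler_peMr; [exact: ltW|apply: exprn_ege1; rewrite ler1n].
  have a_dev j t : `|prob P (\bigcap_(i in [set` ([set: I] :\ j)%SET]) D (w i t)) -
      eps * eps ^+ q| <= deviation q.+1.
    by have := wdev _ t (neT j); rewrite cardD1 exprS.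
  have b_dev t : `|prob P (capB t) - eps ^+ q| <= deviation q.
    by have := wdev _ t BneT; rewrite cardB.
  have fullX : 4 * (delta * 4 ^+ q) = delta * 4 ^+ q.+1 by rewrite exprS; ring.
  have [above|below] := leP (eps ^+ q.+2)
      (prob P (\bigcap_(j in [set: I]) D (u j))).
    exists false => t; rewrite /cond_prob -fullE -BE.
    apply: (increment_above (X := delta * 4 ^+ q) (y := eps ^+ q) eps01 X_ge
      deltaM dev_hi _ (a_dev s t)); first by rewrite -exprS.
      by apply: prob_le1; rewrite BE; apply: measurableI.
    rewrite fullX -!exprS; have := wfull t; have := full_dev.
    rewrite ger0_norm ?subr_ge0 // ler_norml => h1 /andP[h2 _].
    by move: h1 h2; rewrite /full; lra.
  exists true => t; rewrite /cond_prob.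
  rewrite [_ `&` (_ `&` capB t)]setICA !prob_setCI //; last exact: measurableI.
  rewrite [D (w j0 t) `&` (_ `&` _)]setICA -fullE -BE -BE'.
  have /andP[eps_gt0 eps_le1] := eps01.
  have a_ge0 j : 0 <= prob P (\bigcap_(i in [set` ([set: I] :\ j)%SET]) D (w i t)).
    by rewrite /prob fine_ge0.
  apply: (increment_below (X := delta * 4 ^+ q) (y := eps ^+ q) eps01 delta_gt0
    M_gt0 deltaM dev0 dev_sum0 dev_sum M_le' (a_dev s t) (b_dev t) (a_dev j0 t)).
    by have := prob_le1 P (mB t); have := a_ge0 s; lra.
  rewrite fullX -!exprS; have := wfull t; have := full_dev.
  rewrite ltr0_norm ?subr_lt0 // ler_norml => h1 /andP[_ h2].
  by move: h1 h2; rewrite /full; lra.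
have [S SV SE] : exists2 S, simplicial_in V S &
    forall t, S (canonical_iso V t) = \bigcap_(j in [set j | j != s]) X c j t.
  apply: simplicial_in_extend.
  apply: (@simplicial_bigcap _ _ _ _ _ _ (fun i j => tnth rho i j)) => //.
  - by move=> j t; rewrite /X; case: ifP => _; [apply: measurableC|].
  (* A reduced row where two words differ gives the block separating them. *)
  - move=> j js; have : u j != u s by rewrite (inj_eq u_inj).
    case/reduced_separates => row rowR rowjs.
    have /tnthP[i rowE] : row \in rho by [].
    by exists i; rewrite -rowE.
  - by move=> i j t t' /copy_insensitive tt'; rewrite /X /w (tt' a0 _ ldn).
exists V, S; split=> // _ /imsetP[t _ ->].
by rewrite SE XE VE; apply: cP.
Qed.

End Copies.

(** * Minimal deviating sets and the choice of constants *)

Theorem theorem8p5 (R : realType) (k kappa m : nat) (eps sigma eta : R)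
    (hk : (2 <= k)%N) (hkappa : (2 <= kappa)%N) (hm : (1 <= m)%N)
    (hkm : (kappa <= k ^ m)%N)
    (eps_gt0 : 0 < eps) (sigma_gt0 : 0 < sigma) (eta_gt0 : 0 < eta)
    (heps : eps <= 1 - 1 / (2 * kappa%:R))
    (hsigma : sigma <= eps ^+ (kappa - 1) / (2 * kappa%:R))
    (heta : eta <= sigma / 4 ^+ (kappa - 1))
    (A : finType) (hA : #|A| = k) (n : nat) (hn : (m < n)%N)
    (disp : measure_display) (T : measurableType disp) (P : probability T R)
    (D : n.-tuple A -> set T)
    (hD : is_process D) (D_stat : stationary P eta D)
    (D_eps : forall t, `|prob P (D t) - eps| <= eta) :
  (forall G : {set n.-tuple A}, G != finset.set0 -> (#|G| <= kappa)%N ->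
     (type_dim G <= m)%N ->
     `|prob P (\bigcap_(t in [set` G]) D t) - eps ^+ #|G| | <= sigma)
  \/
  (exists l : nat, (1 <= l <= m)%N /\
     forall r : 'I_l -> nat, (forall i, (0 < r i)%N) ->
       (\sum_(i < l) r i <= n - m)%N ->
       exists (V : comb_space A n (\sum_(i < l) r i)) (S : n.-tuple A -> set T),
         simplicial_in V S /\
         forall t, t \in points V ->
           prob P (S t) >= eps ^+ (kappa - 1) / (4 * kappa%:R) /\
           cond_prob P (D t) (S t) >= eps + sigma / 4 ^+ (kappa - 1)).
Proof.
(* The increment of the conclusion serves as unit: [sigma] is [delta * 4 ^+ (kappa - 1)], and the
   threshold in [bad] grows by a factor 4 with each word after the first. *)
pose delta := sigma / 4 ^+ (kappa - 1).
pose E := eps ^+ (kappa - 1).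
have E_gt0 : 0 < E by apply: exprn_gt0.
have delta_gt0 : 0 < delta by rewrite divr_gt0 ?exprn_gt0.
have kR : 2 <= kappa%:R :> R by rewrite ler_nat.
have eps_le1 : eps <= 1.
  by apply: le_trans heps _; rewrite gerBl divr_ge0 //; lra.
have sigmaE : sigma = delta * 4 ^+ (kappa - 1).
  by rewrite /delta divfK // lt0r_neq0 // exprn_gt0.
have pow4 i j : (i <= j)%N -> delta * 4 ^+ i <= delta * 4 ^+ j.
  by move=> ij; rewrite ler_pM2l //; apply: ler_weXn2l => //; rewrite ler1n.
pose dev (F : {set n.-tuple A}) : R :=
  `|prob P (\bigcap_(t in [set` F]) D t) - eps ^+ #|F| |.
pose bad (F : {set n.-tuple A}) := delta * 4 ^+ (#|F|.-1) < dev F.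
have [all_good|] := boolP [forall G : {set n.-tuple A},
  [&& G != finset.set0, (#|G| <= kappa)%N & (type_dim G <= m)%N] ==>
  (dev G <= sigma)].
  left=> G G0 Gk Gm; have /forallP/(_ G)/implyP := all_good; apply.
  by rewrite G0 Gk Gm.
rewrite negb_forall => /existsP[G]; rewrite negb_imply -ltNge.
case/andP => /and3P[G0 Gk Gm] Gdev; right.
have Gbad : bad G.
  by apply: le_lt_trans Gdev; rewrite sigmaE pow4 // -subn1 leq_sub2r.
(* Minimality bounds the deviation of all proper subsets of [F]; the bounds on size and type
   dimension pass from [G] to [F]. *)
have [F /minsetP[Fbad Fmin] FG] := minset_exists Gbad.
(* The empty set does not deviate, and one word deviates by at most [eta <= delta]. *)
have [q cardF] : exists q, #|F| = q.+2.
  case cF: #|F| => [|[|q]]; last by exists q.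
    move: Fbad; rewrite /bad /dev cF; move/eqP: cF; rewrite cards_eq0 => /eqP ->.
    rewrite (_ : [set` _] = set0); last by apply/seteqP; split=> x //=; rewrite inE.
    by rewrite bigcap_set0 prob_setT expr0 subrr normr0 mulr1 ltNge ltW.
  move: Fbad; rewrite /bad /dev cF; move/eqP: cF => /cards1P[t ->].
  rewrite (_ : [set` _] = [set t]); last by apply/seteqP; split=> x /=; rewrite inE => /eqP.
  by rewrite bigcap_set1 expr1 mulr1 ltNge (le_trans (D_eps t) heta).
pose I : finType := {x : n.-tuple A | x \in F}; pose u : I -> n.-tuple A := val.
have cardI : #|I| = q.+2 by rewrite card_sig -cardF; apply: eq_card => x.
have imF (J : {set I}) : u @: J \subset F.
  by apply/fintype.subsetP => _ /imsetP[x _ ->]; apply: valP.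
have imFE : u @: [set: I]%SET = F.
  apply/setP => x; apply/imsetP/idP => [[y _ ->]|xF]; first exact: valP.
  by exists (Sub x xF).
have sub_dev (J : {set I}) : J != [set: I]%SET ->
    `|prob P (\bigcap_(j in [set` J]) D (u j)) - eps ^+ #|J| |
      <= delta * 4 ^+ (#|J|.-1).
  move=> JT; rewrite -(card_imset _ (val_inj : injective u)) -bigcap_imset leNgt.
  apply: contraNN JT => /Fmin/(_ (imF J)); rewrite -imFE => /(imset_inj val_inj) ->.
  exact: eqxx.
have full_dev : delta * 4 ^+ q.+1 <
    `|prob P (\bigcap_(j in [set: I]) D (u j)) - eps ^+ q.+2|.
  have := Fbad; rewrite /bad /dev cardF -imFE bigcap_imset.
  by rewrite (_ : [set` _] = [set: I]) //; apply/seteqP; split=> x //=; rewrite inE.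
have qk : (q.+1 <= kappa - 1)%N.
  by rewrite leq_subRL ?(ltnW hkappa) // add1n -cardF (leq_trans (subset_leq_card FG)).
have epsX i : (i <= kappa - 1)%N -> E <= eps ^+ i.
  by move=> ik; apply: ler_wiXn2l => //; exact: ltW.
pose M := E / (4 * kappa%:R).
have k_gt0 : 0 < kappa%:R :> R by lra.
have M_gt0 : 0 < M by rewrite divr_gt0 // mulr_gt0.
have ME : 2 * M = E / (2 * kappa%:R) by rewrite /M; field; lra.
have inv_k : 1 / (2 * kappa%:R) <= 1 :> R by rewrite ler_pdivrMr ?mulr_gt0 //; lra.
have inv_k0 : 0 <= 1 / (2 * kappa%:R) :> R by rewrite divr_ge0 // ltW // mulr_gt0.
(* By [hsigma], [sigma <= 2 * M], while [2 * (delta * 4 ^+ q)] is half of [delta * 4 ^+ q.+1], hence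
   at most half of [sigma]. *)
have deltaM : 2 * (delta * 4 ^+ q) <= M.
  by have := pow4 _ _ qk; rewrite -sigmaE exprS; move: hsigma; rewrite -/E -ME; lra.
have ME' : 2 * M = E * (1 / (2 * kappa%:R)) by rewrite ME; field; lra.
have M_le : 2 * M <= eps ^+ q.+1.
  by apply: le_trans (epsX _ qk); rewrite ME' ler_piMr // ltW.
(* The upper bound [heps] keeps [1 - eps] at least [1 / (2 * kappa%:R)], so the complemented event
   is not too small. *)
have M_le' : 2 * M <= eps ^+ q * (1 - eps).
  rewrite ME'; apply: ler_pM => //; [exact: ltW|exact: epsX (ltnW qk)|lra].
pose l := size (reduced (rows u)).
have l_le : (l <= m)%N by apply: leq_trans Gm; apply: size_reduced_subset.
(* The witness is the dimension of the type of [F]; it is positive because two distinct words differ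
   in a varying row. *)
exists l; split.
  rewrite l_le andbT.
  have [i [j [_ _ ij]]] : exists i j : I, [/\ i \in I, j \in I & i != j].
    by apply/card_gt1P; rewrite cardI.
  have : u i != u j by rewrite (inj_eq val_inj).
  by case/reduced_separates => row; rewrite /l; case: (reduced _).
move=> r _ rn.
apply: (simplicial_increment hD D_stat D_eps heta _ val_inj cardI sub_dev full_dev)
  => //.
- by rewrite hA.
- by rewrite eps_gt0.
(* At most [m] fixed rows and at most [n - m] variables fit into length [n]. *)
- by apply: leq_trans (leq_add l_le rn) _; rewrite subnKC // ltnW.
Qed.
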